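(* In the bichromatic Maker-Breaker game with bias $1:12$ and any $k\geq 8$, Breaker has a winning strategy.
   Context: Bichromatic Maker-Breaker game with bias $1:s$: Maker and Breaker alternately place points in the plane, Maker starting; in each round Maker places one point and then Breaker places $s$ points. Let $M$ and $B$ be the sets of points placed by Maker and Breaker; $S=M\cup B$ must always be in general position (no three collinear). Maker wins if at some time there is a $k$-hole $H$ of $S$ with $H\subseteq M$; Breaker wins if she can prolong the game indefinitely without this happening. A $k$-hole of $S$ is a subset $H\subseteq S$ of size $k$ such that $\mathrm{conv}(H)$ is a convex $k$-gon and $\mathrm{conv}(H)\cap S=H$. *)

(* Defs.v *)
From HB Require Import structures.
From mathcomp Require Import all_boot all_order all_algebra.
From mathcomp Require Import boolp classical_sets functions cardinality reals convex.
Set Implicit Arguments.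
Unset Strict Implicit.
Unset Printing Implicit Defensive.
Import Order.TTheory GRing.Theory Num.Theory.
Local Open Scope card_scope.
Local Open Scope classical_set_scope.
Local Open Scope ring_scope.

Section Geometry.
Variable R : realType.

Definition point := 'rV[R]_2.

Implicit Types (A C S H : set point) (x y z : point) (k : nat).

Definition collinear A :=
  exists p d : point, d != 0 /\ A `<=` [set p + t *: d | t in [set: R]].

Definition general_position S :=
  forall x y z, S x -> S y -> S z -> x != y -> y != z -> x != z ->
    ~ collinear [set x; y; z].

Definition conv_hull A : set point := smallest (@convex_set R point) A.

(* The vertices of a convex polygon are its extreme points. *)
Definition vertices C : set point :=
  [set x | C x /\ forall y z (t : R), C y -> C z -> 0 < t < 1 ->
     x = t *: y + (1 - t) *: z -> y = x /\ z = x].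

(* Non-collinearity excludes the degenerate polygons (points, segments). *)
Definition convex_polygon C :=
  exists A, [/\ finite_set A, ~ collinear A & C = conv_hull A].

Definition convex_gon k C := convex_polygon C /\ vertices C #= `I_k.

Definition hole k S H :=
  [/\ H `<=` S, H #= `I_k, convex_gon k (conv_hull H)
    & conv_hull H `&` S = H].

End Geometry.

Section Game.
Variables (R : realType) (s k : nat).

(* The list of all points placed so far, oldest first.  A round consists of
   s.+1 placements, the first of which is Maker's, so that the owner of a point
   is determined by its index modulo s.+1. *)
Definition history := seq (point R).

Implicit Types (h : history) (x : point R).

Definition maker_index (i : nat) : bool := (s.+1 %| i)%N.

Definition maker_points h : set (point R) :=
  [set nth 0 h i | i in [set i | (i < size h)%N && maker_index i]].

Definition legal h x := x \notin h /\ general_position [set` rcons h x].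

Definition maker_won h :=
  exists H, hole k [set` h] H /\ H `<=` maker_points h.

Definition strategy := history -> point R.

Inductive reachable (sigma : strategy) : history -> Prop :=
| reachable_start : reachable sigma [::]
| reachable_maker h x : reachable sigma h -> maker_index (size h) ->
    legal h x -> reachable sigma (rcons h x)
| reachable_breaker h : reachable sigma h -> ~~ maker_index (size h) ->
    reachable sigma (rcons h (sigma h)).

(* Every Breaker move is legal, so the game never stops on Breaker's turn, and
   Maker has not won after any single placement of either player. *)
Definition breaker_winning (sigma : strategy) :=
  forall h, reachable sigma h ->
    (~~ maker_index (size h) -> legal h (sigma h)) /\ ~ maker_won h.

Definition breaker_has_winning_strategy :=
  exists sigma : strategy, breaker_winning sigma.

End Game.

(* Main.v *)
(* Breaker keeps pairwise disjoint balls around Maker's points.  A new point y of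
   Maker falls in the ball of at most one old point v; Breaker shrinks the ball
   of v, gives y a small ball, and places a tiny cluster of three points, in
   three directions roughly 120 degrees apart, around y and around v.

   Let H be a hole with vertices among Maker's points, and v a vertex of H whose
   cluster is up to date and which has two earlier vertices a, b in H.  The
   other vertices of H lie outside the ball of v, and the cluster of v is tiny
   compared with this ball and with the angle avb, so a cluster point whose
   direction lies inside the angle of H at v would belong to conv H.  Hence H
   lies in one of the three sectors cut out by the cluster at v, so that one of
   three fixed linear forms is positive on w - v for all other vertices w.  Two
   vertices cannot share the same form, so at most three vertices are of this
   kind.  The others are the two oldest vertices, y and v: at most seven in all. *)
From HB Require Import structures.
From mathcomp Require Import all_boot all_order all_algebra.
From mathcomp Require Import boolp classical_sets functions cardinality reals convex.
From mathcomp Require Import interval_inference ring lra zify.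
Require Import Defs.
Set Implicit Arguments.
Unset Strict Implicit.
Unset Printing Implicit Defensive.
Import Order.TTheory GRing.Theory Num.Theory.
Local Open Scope card_scope.
Local Open Scope classical_set_scope.
Local Open Scope ring_scope.

(** * Planar vectors, determinants and general position *)

Section Vectors.
Variable R : realType.
Implicit Types (p q u v w : point R) (e t : R).

Definition cross p q : R := p 0 0 * q 0 1 - p 0 1 * q 0 0.

Definition norm1 p : R := `|p 0 0| + `|p 0 1|.

Lemma pointP p q : p 0 0 = q 0 0 -> p 0 1 = q 0 1 -> p = q.
Proof.
move=> e0 e1; apply/rowP => i.
by case: (unliftP 0 i) => [j|] -> //; rewrite (ord1 j) (_ : lift _ _ = 1) //; apply: val_inj.
Qed.

Lemma norm1N p : norm1 (- p) = norm1 p.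
Proof. by rewrite /norm1 !mxE !normrN. Qed.

Lemma norm1Z e p : norm1 (e *: p) = `|e| * norm1 p.
Proof. by rewrite /norm1 !mxE !normrM mulrDr. Qed.

Lemma norm1_triangle p q : norm1 (p + q) <= norm1 p + norm1 q.
Proof.
rewrite /norm1 !mxE; have := ler_normD (p 0 0) (q 0 0).
have := ler_normD (p 0 1) (q 0 1); lra.
Qed.

Lemma norm1_gt0 p : (0 < norm1 p) = (p != 0).
Proof.
apply/idP/idP; first by apply: contraTneq => ->; rewrite /norm1 !mxE normr0; lra.
apply: contraNT; rewrite -leNgt /norm1 => le0; apply/eqP/pointP; rewrite mxE; apply/eqP;
  rewrite -normr_eq0; apply/eqP; have := normr_ge0 (p 0 0); have := normr_ge0 (p 0 1); lra.
Qed.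

Lemma cross_collinear p q v : p != v ->
  cross (p - v) (q - v) = 0 -> collinear [set v; p; q].
Proof.
move=> pv c0; exists v, (p - v); split; first by rewrite subr_eq0.
have [p0|p0] := eqVneq ((p - v) 0 0) 0.
- have p1 : (p - v) 0 1 != 0.
    apply: contra_neq pv => p1; apply/eqP; rewrite -subr_eq0; apply/eqP.
    by apply: pointP; rewrite ?p0 ?p1 mxE.
  move: c0; rewrite /cross p0 mul0r sub0r => /eqP; rewrite oppr_eq0 mulf_eq0 (negPf p1) => /eqP q0.
  move=> _ [[->|->]|->]; [by exists 0; rewrite // scale0r addr0|by exists 1; rewrite // scale1r addrC subrK|].
  exists ((q - v) 0 1 / (p - v) 0 1) => //.
  by apply: pointP; move: p0 p1 q0; rewrite !mxE => p0 p1 q0; [rewrite p0; lra | field].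
- move: c0; rewrite /cross => c0.
  move=> _ [[->|->]|->]; [by exists 0; rewrite // scale0r addr0|by exists 1; rewrite // scale1r addrC subrK|].
  exists ((q - v) 0 0 / (p - v) 0 0) => //.
  apply: pointP; move: p0 c0; rewrite !mxE => p0 c0; first by field.
  by apply: (mulfI p0); rewrite mulrDr mulrA mulrCA divff // mulr1; lra.
Qed.

Lemma cross_neq0 p q v : cross (p - v) (q - v) != 0 -> ~ collinear [set v; p; q].
Proof.
move=> /eqP c0 [x [d [d0 sub]]]; apply: c0.
have [a _ va] := sub v (or_introl (or_introl erefl)).
have [b _ pb] := sub p (or_introl (or_intror erefl)).
have [c _ qc] := sub q (or_intror erefl).
by rewrite -va -pb -qc /cross !mxE; ring.
Qed.

Lemma general_position_cross S p q v : general_position S -> S v -> S p -> S q ->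
  p != v -> q != v -> p != q -> cross (p - v) (q - v) != 0.
Proof.
move=> gp Sv Sp Sq pv qv pq; apply/eqP => c0.
apply: (gp v p q) => //; rewrite 1?eq_sym //.
exact: cross_collinear.
Qed.

Lemma legal_rcons h v : v \notin h -> general_position [set` h] ->
  (forall p q, p \in h -> q \in h -> p != q -> cross (p - v) (q - v) != 0) ->
  legal h v.
Proof.
move=> vh gp cr; split=> // x y z /=; rewrite !mem_rcons !inE.
have aux p q A : p \in h -> q \in h -> p != q -> [set v; p; q] `<=` A -> ~ collinear A.
  move=> ph qh pq sub cA; apply: (cross_neq0 (cr p q ph qh pq)).
  by case: cA => [x0 [d [d0 s]]]; exists x0, d; split=> // w /sub/s.
move=> /predU1P[->|xh] /predU1P[->|yh] /predU1P[->|zh]; rewrite ?eqxx // => xy yz xz.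
- apply: (@aux y z) => //.
- by apply: (@aux x z) => // w [[->|->]|->] /=; tauto.
- by apply: (@aux x y) => // w [[->|->]|->] /=; tauto.
- exact: gp.
Qed.

End Vectors.

(** * Properties of all sufficiently small positive reals *)

Section Small.
Variable R : realType.

Definition small (P : R -> Prop) := exists2 d : R, 0 < d & forall e, 0 < e < d -> P e.

Lemma small_exists P : small P -> exists2 e, 0 < e & P e.
Proof. by move=> [d d0 dP]; exists (d / 2); [lra | apply: dP; lra]. Qed.

Lemma small_and P Q : small P -> small Q -> small (fun e => P e /\ Q e).
Proof.
move=> [d d0 dP] [d' d'0 dQ]; exists (Num.min d d'); first by rewrite lt_min d0.
by move=> e /andP[e0]; rewrite lt_min => /andP[ed ed']; split; [apply: dP|apply: dQ]; apply/andP.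
Qed.

Lemma small_imp (P Q : R -> Prop) : (forall e, 0 < e -> P e -> Q e) -> small P -> small Q.
Proof. by move=> PQ [d d0 dP]; exists d => // e /[dup] /andP[e0 _] /dP; exact: PQ. Qed.

Lemma small_true (P : R -> Prop) : (forall e, 0 < e -> P e) -> small P.
Proof. by move=> eP; exists 1 => // e /andP[/eP]. Qed.

Lemma small_all (T : eqType) (s : seq T) (P : T -> R -> Prop) :
  (forall x, x \in s -> small (P x)) -> small (fun e => forall x, x \in s -> P x e).
Proof.
elim: s => [|x s IH] sP; first by apply: small_true.
have := small_and (sP x (mem_head _ _)) (IH (fun y ys => sP y (@mem_behead _ (x :: s) y ys))).
by apply: small_imp => e _ [Px Ps] y; rewrite inE => /predU1P[->//|/Ps].
Qed.

Lemma small_lt (c : R) : 0 < c -> small (fun e => e < c).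
Proof. by move=> c0; exists c => // e /andP[]. Qed.

Lemma small_affine_neq0 (a b : R) : (a != 0) || (b != 0) -> small (fun e => a + e * b != 0).
Proof.
have [->/= b0|a0 _] := eqVneq a 0.
  by apply: small_true => e e0; rewrite add0r mulf_neq0 // gt_eqF.
have := small_lt (c := `|a| / (`|b| + 1)).
have b1 : 0 < `|b| + 1 by rewrite ltr_wpDl.
move=> /(_ (divr_gt0 _ b1)); rewrite normr_gt0 => /(_ a0).
apply: small_imp => e e0; rewrite ltr_pdivlMr // => lt; apply: contraTneq lt => ab.
have -> : a = - (e * b) by lra.
by rewrite -leNgt normrN normrM (gtr0_norm e0) ler_wpM2l ?ler_wpDr // ltW.
Qed.

Lemma exists_avoiding (s : seq R) (a b : R) : a < b ->
  exists2 t, a < t < b & t \notin s.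
Proof.
elim: s a b => [|x s IH] a b ab; first by exists ((a + b) / 2); [lra|].
have [/andP[ax xb]|x_out] := boolP (a < x < b).
- have [t /andP[at_ tx] ts] := IH a x ax.
  by exists t; [lra | rewrite inE negb_or ts lt_eqF].
- have [t tab ts] := IH a b ab.
  by exists t; rewrite // inE negb_or ts andbT; apply: contraNneq x_out => <-.
Qed.

End Small.

(** * Triangles that catch a short vector *)

Section Trap.
Variable R : realType.
Implicit Types (p q u v w A B X : point R) (e t r s : R).

Lemma cross_gt0_neq0 s u A : 0 < s * cross u A -> (u != 0) && (A != 0).
Proof.
move=> lt; apply/andP; split; apply: contraTneq lt => ->;
  by rewrite /cross !mxE !(mul0r, mulr0) subr0 mulr0 ltxx.
Qed.

(** Membership in the triangle with vertices [0], [X] and [A]. *)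
Definition sub_combination (U X A : point R) :=
  exists a b : R, [/\ 0 <= a, 0 <= b, a + b <= 1 & U = a *: X + b *: A].

(** Up to the orientation [s], the directions come in the order [X], [u], [A], [B], with [X] and [B]
    at most a half-turn apart. The fixed angle from [A] to [B] keeps the angle between [X] and [A]
    away from a half-turn, so the side from [X] to [A] cuts the ray of [u] at a distance bounded
    below independently of [X]. *)
Lemma small_trap s r u A B : 0 < r ->
  0 < s * cross u A -> 0 < s * cross u B -> 0 < s * cross A B ->
  small (fun e => forall X, r <= norm1 X -> 0 < s * cross X u -> 0 <= s * cross X B ->
    sub_combination (e *: u) X A).
Proof.
move=> r0 uA uB AB.
have /andP[u0 _] := cross_gt0_neq0 uA; have /andP[_ B0] := cross_gt0_neq0 uB.
set a := s * cross u A in uA *; set b := s * cross u B in uB *; set c := s * cross A B in AB *.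
have Nu : 0 < norm1 u by rewrite norm1_gt0.
have NB : 0 < norm1 B by rewrite norm1_gt0.
(* By [NX] and the two bounds on [m], [m * r * b <= a * y + c / 2 * x]; the other half of [c * x]
   pays for [e * b * x]. The outcome [d_ge] makes the Cramer coefficients add up to at most 1. *)
pose m := Num.min (c / 2 / norm1 B) (a / norm1 u).
have m0 : 0 < m by rewrite lt_min !divr_gt0.
have mB : m * norm1 B <= c / 2 by rewrite -ler_pdivlMr // ge_min lexx.
have mu : m * norm1 u <= a by rewrite -ler_pdivlMr // ge_min lexx orbT.
have cb0 : 0 < c / 2 / b := divr_gt0 (divr_gt0 AB (ltr0Sn _ 1)) uB.
have mra0 : 0 < m * r / a := divr_gt0 (mulr_gt0 m0 r0) uA.
have := small_and (small_lt cb0) (small_lt mra0).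
apply: small_imp => e e0 [+ +] X rX Xu XB; rewrite (ltr_pdivlMr _ _ uB) (ltr_pdivlMr _ _ uA) => eb ea.
set x := s * cross X u in Xu; set y := s * cross X B in XB.
have bd : b * (s * cross X A) = c * x + a * y by rewrite /a /b /c /x /y /cross; ring.
have NX : norm1 X * b <= y * norm1 u + x * norm1 B.
  have X0 : X 0 0 * b = y * u 0 0 - x * B 0 0 by rewrite /b /x /y /cross; ring.
  have X1 : X 0 1 * b = y * u 0 1 - x * B 0 1 by rewrite /b /x /y /cross; ring.
  clearbody b x y; rewrite /norm1 mulrDl -{1 2}(gtr0_norm uB) -!normrM X0 X1.
  apply: le_trans (lerD (ler_normB _ _) (ler_normB _ _)) _.
  by rewrite !normrM (ger0_norm XB) (gtr0_norm Xu); lra.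
have d_ge : e * (a + x) <= s * cross X A.
  rewrite -(ler_pM2l uB) bd.
  have h1 : e * b * x <= c / 2 * x by rewrite ler_wpM2r ?ltW.
  have h2 : e * a * b <= m * r * b by rewrite ler_wpM2r ?ltW.
  have h3 : m * (r * b) <= m * (y * norm1 u + x * norm1 B).
    apply: (ler_wpM2l (ltW m0)); apply: le_trans NX.
    exact: ler_wpM2r (ltW uB) _ _ rX.
  have h4 : y * (m * norm1 u) <= y * a by rewrite ler_wpM2l.
  have h5 : x * (m * norm1 B) <= x * (c / 2) := ler_wpM2l (ltW Xu) mB.
  by lra.
have d0 : 0 < s * cross X A by apply: lt_le_trans d_ge; rewrite mulr_gt0 // addr_gt0.
exists (e * a / (s * cross X A)), (e * x / (s * cross X A)); split.
- exact: divr_ge0 (mulr_ge0 (ltW e0) (ltW uA)) (ltW d0).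
- exact: divr_ge0 (mulr_ge0 (ltW e0) (ltW Xu)) (ltW d0).
- by rewrite -mulrDl ler_pdivrMr // mul1r -mulrDr.
- have := d0; rewrite /a /x /cross => /lt0r_neq0 d_neq0.
  have /andP[s0 c0] : (s != 0) && (X 0 0 * A 0 1 - X 0 1 * A 0 0 != 0).
    by move: d_neq0; rewrite mulf_eq0 negb_or.
  by apply: pointP; rewrite !mxE; field; apply/andP.
Qed.

(** Cramer's rule gives both coefficients, and they are proportional to [e]. *)
Lemma small_between u A B :
  0 < cross A u -> 0 < cross u B -> 0 < cross A B ->
  small (fun e => sub_combination (e *: u) A B).
Proof.
move=> Au uB AB.
have D := addr_gt0 uB Au.
have := small_lt (divr_gt0 AB D); apply: small_imp => e e0.
rewrite (ltr_pdivlMr _ _ D) => lt.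
exists (e * cross u B / cross A B), (e * cross A u / cross A B); split.
- exact: divr_ge0 (mulr_ge0 (ltW e0) (ltW uB)) (ltW AB).
- exact: divr_ge0 (mulr_ge0 (ltW e0) (ltW Au)) (ltW AB).
- by rewrite -mulrDl ler_pdivrMr // mul1r -mulrDr ltW.
- by have := lt0r_neq0 AB; rewrite /cross => AB0; apply: pointP; rewrite !mxE; field.
Qed.

End Trap.

(** * Convex hulls and the angle of a hole at a vertex *)

Section Hull.
Variable R : realType.
Implicit Types (p q u v w A B X : point R) (e t r s : R) (C H S : set (point R)).

Lemma convex_setP C : convex_set C <->
  (forall x y t, 0 <= t <= 1 -> C x -> C y -> C (t *: x + (1 - t) *: y)).
Proof.
split=> [cC x y t t01 Cx Cy|cC x y l]; last first.
  by rewrite !inE => Cx Cy; apply: (cC x y _ _ Cx Cy); rewrite ge0 le1.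
have t01' : Itv.spec (@Itv.num_sem R) (Itv.Real `[0%Z, 1%Z]) t.
  by rewrite /= /Itv.num_sem /= in_itv /= num_real.
by have := cC x y (Itv.mk t01'); rewrite !inE; apply.
Qed.

Lemma conv_hull_sub H : H `<=` conv_hull H.
Proof. exact: sub_gen_smallest. Qed.

Lemma conv_hull_conv H x y t : 0 <= t <= 1 -> conv_hull H x -> conv_hull H y ->
  conv_hull H (t *: x + (1 - t) *: y).
Proof.
move=> t01 Hx Hy M [cM HM]; move/convex_setP: (cM); apply=> //; [exact: Hx|exact: Hy].
Qed.

Lemma conv_hull_sub_combination H v w q u : conv_hull H v -> conv_hull H w -> conv_hull H q ->
  sub_combination u (w - v) (q - v) -> conv_hull H (v + u).
Proof.
move=> Hv Hw Hq [a [b [a0 b0 ab1 ->]]].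
(* The nested two-point combination below divides by [1 - a]. *)
have [a1|a_neq1] := eqVneq a 1.
  have -> : b = 0 by lra.
  by rewrite a1 scale1r scale0r addr0 addrC subrK.
have a1 : a < 1 by rewrite lt_neqAle a_neq1; lra.
have -> : v + (a *: (w - v) + b *: (q - v)) =
    a *: w + (1 - a) *: (b / (1 - a) *: q + (1 - b / (1 - a)) *: v).
  by apply: pointP; rewrite !mxE; field; lra.
apply: conv_hull_conv => //; first lra.
apply: conv_hull_conv => //; rewrite divr_ge0 //=; last lra.
by rewrite ler_pdivrMr; lra.
Qed.

(** Deleting an extreme point from a convex set preserves convexity. Deleting one outside [H] would
    leave a smaller convex set containing [H]. *)
Lemma vertices_conv_hull H : vertices (conv_hull H) `<=` H.
Proof.
move=> x [Cx ext]; apply: contrapT => Hx.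
suff /(_ x Cx) [_ /(_ erefl)] : conv_hull H `<=` conv_hull H `\ x by [].
apply: smallest_sub; last first.
  move=> y Hy; split; first exact: conv_hull_sub.
  by move=> yx; apply: Hx; rewrite -yx.
apply/convex_setP => y z t t01 [Cy yx] [Cz zx]; split; first exact: conv_hull_conv.
have [->|t0] := eqVneq t 0; first by rewrite scale0r add0r subr0 scale1r.
have [->|t1] := eqVneq t 1; first by rewrite subrr scale0r addr0 scale1r.
move=> /= eq_x; have [|//] := ext y z t Cy Cz _ (esym eq_x).
case/andP: t01 => t_ge0 t_le1.
by rewrite (lt_neqAle t 1) t1 t_le1 lt_neqAle eq_sym t0 t_ge0.
Qed.

(** By [vertices_conv_hull] the vertices lie in [H], and both sets have [k] elements. *)
Lemma hole_vertices k S H : hole k S H -> H `<=` vertices (conv_hull H).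
Proof.
move=> [_ Hk [_ Vk] _].
have finH : finite_set H by apply/finite_setP; exists k.
have finV : finite_set (vertices (conv_hull H)) by apply/finite_setP; exists k.
suff -> : vertices (conv_hull H) = H by [].
apply: (fset_set_inj finV finH); apply/finmap.fsetP.
apply/finmap.fsubset_cardP; first by rewrite (card_fset_set Hk) (card_fset_set Vk).
by rewrite -fset_set_sub //; exact: vertices_conv_hull.
Qed.

Lemma vertex_not_between C v u s t : vertices C v -> u != 0 -> 0 < s -> 0 < t ->
  C (v + s *: u) -> ~ C (v - t *: u).
Proof.
move=> [_ ext] u0 s0 t0 Cs Ct.
have st0 : 0 < s + t by lra.
have [||vs _] := ext _ _ (t / (s + t)) Cs Ct.
- by rewrite divr_gt0 //= ltr_pdivrMr; lra.
- by apply: pointP; rewrite !mxE; field; lra.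
- move: vs; rewrite -[RHS]addr0 => /addrI /eqP; rewrite scaler_eq0 (negPf u0) orbF; lra.
Qed.

Lemma cone_ray H v w w' u : conv_hull H v -> conv_hull H w -> conv_hull H w' ->
  0 < cross (w - v) u -> 0 < cross u (w' - v) -> 0 < cross (w - v) (w' - v) ->
  exists2 t, 0 < t & conv_hull H (v + t *: u).
Proof.
move=> Hv Hw Hw' wu uw' ww'.
have [t t0 comb] := small_exists (small_between wu uw' ww').
by exists t => //; exact: conv_hull_sub_combination comb.
Qed.

(** The first clause serves a [u] outside the angle from [A] to [B]; the sign selects the side, and
    [X] comes after [e] because it may be a point played later. The second clause serves a [u]
    inside that angle. *)
Definition catches r u A B e : Prop :=
  (forall (s : bool) X, 0 < (-1) ^+ s * cross u A -> 0 < (-1) ^+ s * cross u B ->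
     0 < (-1) ^+ s * cross A B -> r <= norm1 X -> 0 < (-1) ^+ s * cross X u ->
     0 <= (-1) ^+ s * cross X B -> sub_combination (e *: u) X A) /\
  (0 < cross A u -> 0 < cross u B -> 0 < cross A B -> sub_combination (e *: u) A B).

Lemma small_catches r u A B : 0 < r -> small (catches r u A B).
Proof.
move=> r0.
have small_if (b : bool) (P : R -> Prop) : (b -> small P) -> small (fun e => b -> P e).
  by case: b => sP; [apply: small_imp (sP isT) | apply: small_true].
have side (s : bool) : small (fun e => forall X, 0 < (-1) ^+ s * cross u A ->
    0 < (-1) ^+ s * cross u B -> 0 < (-1) ^+ s * cross A B -> r <= norm1 X ->
    0 < (-1) ^+ s * cross X u -> 0 <= (-1) ^+ s * cross X B ->
    sub_combination (e *: u) X A).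
  have : small (fun e => 0 < (-1) ^+ s * cross u A -> 0 < (-1) ^+ s * cross u B ->
      0 < (-1) ^+ s * cross A B -> forall X, r <= norm1 X ->
      0 < (-1) ^+ s * cross X u -> 0 <= (-1) ^+ s * cross X B ->
      sub_combination (e *: u) X A).
    by do 3 apply: (small_if _ _) => ?; apply: small_trap.
  by apply: small_imp => e _ P X *; apply: P.
have between : small (fun e => 0 < cross A u -> 0 < cross u B -> 0 < cross A B ->
    sub_combination (e *: u) A B).
  by do 3 apply: (small_if _ _) => ?; apply: small_between.
have := small_and (small_and (side true) (side false)) between.
by apply: small_imp => e _ [[P1 P2] P3]; split=> // -[].
Qed.

(* [a] and [b] are known when [e] is chosen, [w] and [w'] are not.  A ray inside
   the angle of the hull at [v] could leave the hull arbitrarily early only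
   through a side seen from [v] under an angle close to a half-turn, which the
   fixed angle at [v] between [a] and [b] rules out. *)
Lemma vertex_catch H v w w' a b u r e : vertices (conv_hull H) v ->
  H w -> H w' -> H a -> H b ->
  0 < cross (w - v) u -> 0 < cross u (w' - v) -> 0 < cross (w - v) (w' - v) ->
  r <= norm1 (w - v) -> r <= norm1 (w' - v) ->
  cross u (a - v) != 0 -> cross u (b - v) != 0 -> 0 < cross (a - v) (b - v) ->
  catches r u (a - v) (b - v) e -> catches r u (b - v) (a - v) e ->
  conv_hull H (v + e *: u).
Proof.
move=> Vv Hw Hw' Ha Hb wu uw' ww' rw rw' ua ub ab cab cba.
have Cv : conv_hull H v by case: Vv.
have [Cw Cw' Ca Cb] := And4 (conv_hull_sub Hw) (conv_hull_sub Hw') (conv_hull_sub Ha) (conv_hull_sub Hb).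
have u0 : u != 0 by apply: contraTneq wu => ->; rewrite /cross !mxE; lra.
have [t t0 Ct] := cone_ray Cv Cw Cw' wu uw' ww'.
have crossN p q : cross p q = - cross q p by rewrite /cross; ring.
(* Otherwise the ray opposite to [u] would enter the hull, and [v] would lie strictly between two
   hull points. *)
have no_opp p q : H p -> H q -> 0 < cross u (p - v) -> 0 < cross (q - v) u ->
    ~ (0 < cross (p - v) (q - v)).
  move=> Hp Hq up qu pq.
  have [||s s0] := @cone_ray H v p q (- u) Cv (conv_hull_sub Hp) (conv_hull_sub Hq) _ _ pq.
  - by move: up; rewrite /cross !mxE; lra.
  - by move: qu; rewrite /cross !mxE; lra.
  - by rewrite scalerN; exact: vertex_not_between Ct.
(* If [a] and [b] lie on the same side of [u], the triangle uses the one whose direction is nearer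
   to [u], together with [w] or [w'] from the other side. If they lie on opposite sides, [u] or
   [- u] is inside their angle, and [no_opp] excludes the latter. *)
have [ua0|ua0] := ltP 0 (cross u (a - v)); have [ub0|ub0] := ltP 0 (cross u (b - v)).
- apply: (conv_hull_sub_combination Cv Cw Ca).
  apply: (proj1 cab false); rewrite /= ?expr0 ?mul1r //.
  by rewrite leNgt crossN oppr_lt0; apply/negP; exact: no_opp.
- by case: (no_opp a b Ha Hb ua0 _ ab); rewrite crossN; lra.
- apply: (conv_hull_sub_combination Cv Ca Cb); apply: (proj2 cab) => //.
  by rewrite crossN; lra.
- have {}ua0 : cross u (a - v) < 0 by rewrite lt_neqAle ua.
  have {}ub0 : cross u (b - v) < 0 by rewrite lt_neqAle ub.
  apply: (conv_hull_sub_combination Cv Cw' Cb).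
  have w'a : cross (w' - v) (a - v) <= 0.
    rewrite leNgt; apply/negP; apply: no_opp => //.
    by rewrite crossN; lra.
  have ba := crossN (b - v) (a - v); have w'u := crossN (w' - v) u.
  by apply: (proj1 cba true) => //=; rewrite expr1; lra.
Qed.

End Hull.

(** * The three-point cluster around a point *)

Section Guard.
Variable R : realType.
Implicit Types (p q u v w A B X : point R) (e t r s : R) (C H S K : set (point R)).
Implicit Types (h L : seq (point R)).

(** For old points [p] and [q] the determinant seen from [v + e *: u] is affine in [e]. Its constant
    term is nonzero when both differ from [v], and its slope is nonzero when one of them is [v]. *)
Lemma small_legal h v u : general_position [set` h] -> v \in h -> u != 0 ->
  (forall p, p \in h -> p != v -> cross u (p - v) != 0) ->
  small (fun e => legal h (v + e *: u)).
Proof.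
move=> gp vh u0 up.
have fresh e : 0 < e -> v + e *: u \notin h.
  move=> e0; apply/negP => ch.
  have cv : v + e *: u != v.
    by rewrite -subr_eq0 [_ + e *: u]addrC addrK scaler_eq0 (negPf u0) orbF gt_eqF.
  by have /eqP := up _ ch cv; apply; rewrite /cross !mxE; ring.
have : small (fun e => forall p, p \in h -> forall q, q \in h ->
    p != q -> cross (p - (v + e *: u)) (q - (v + e *: u)) != 0).
  apply: small_all => p ph; apply: small_all => q qh.
  have [->|pq] := eqVneq p q; first exact: small_true.
  have : small (fun e => cross (p - v) (q - v) + e * (cross u (p - v) - cross u (q - v)) != 0).
    apply: small_affine_neq0.
    have [p_v|pv] := eqVneq p v.
      apply/orP; right; rewrite p_v in pq *; have := up q qh; rewrite eq_sym => /(_ pq).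
      by apply: contraNneq => b0; rewrite -oppr_eq0 -b0 /cross !mxE; apply/eqP; ring.
    have [q_v|qv] := eqVneq q v.
      apply/orP; right; have := up p ph pv; rewrite q_v.
      by apply: contraNneq => b0; rewrite -b0 /cross !mxE; apply/eqP; ring.
    by apply/orP; left; exact: general_position_cross gp _ _ _ _ _ _.
  apply: small_imp => e _.
  have -> : cross (p - (v + e *: u)) (q - (v + e *: u)) =
      cross (p - v) (q - v) + e * (cross u (p - v) - cross u (q - v)).
    by rewrite /cross !mxE; ring.
  by [].
apply: small_imp => e e0 cr; apply: legal_rcons => //; first exact: fresh.
by move=> p q ph qh; apply: cr.
Qed.

(* Consecutive spokes stay less than a half-turn apart for all [-1 < t < 1]; the
   freedom in [t] is what lets a spoke avoid finitely many directions. *)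
Definition spoke (i : nat) t : point R :=
  \row_(j < 2) if j == 0 then (if i == 0%N then 2 else - 1)
               else (if i == 0%N then t else if i == 1%N then 2 + t else t - 2).

Lemma spoke_neq0 i t : spoke i t != 0.
Proof.
apply/eqP => /rowP /(_ 0); rewrite !mxE /=.
by case: ifP => _ /eqP; rewrite ?oppr_eq0 ?pnatr_eq0 ?oner_eq0.
Qed.

Lemma spoke_avoiding h v i :
  exists2 t, -1 < t < 1 & forall p, p \in h -> p != v -> cross (spoke i t) (p - v) != 0.
Proof.
pose x : R := if i == 0%N then 2 else - 1.
pose y : R := if i == 0%N then 0 else if i == 1%N then 2 else - 2.
have x0 : x != 0 by rewrite /x; case: ifP => _; rewrite ?oppr_eq0 ?pnatr_eq0 ?oner_eq0.
have spokeE t : spoke i t = \row_(j < 2) if j == 0 then x else y + t.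
  by apply/rowP => j; rewrite !mxE /x /y; case: (j == 0) => //; do 2?case: ifP => _; lra.
(* Each [p] excludes at most one [t]. A vertical [p - v] excludes none, so the value of the division
   by 0 is harmless. *)
have [|t t1 tbad] := @exists_avoiding R
  [seq x * (p - v) 0 1 / (p - v) 0 0 - y | p <- h] (- 1) 1; first lra.
exists t => // p ph pv; apply: contra tbad; rewrite spokeE /cross !mxE /= => /eqP c0.
apply/mapP; exists p => //; rewrite !mxE.
have [p0|p0] := eqVneq (p 0 0 - v 0 0) 0.
  move: c0; rewrite p0 mulr0 subr0 => /eqP; rewrite mulf_eq0 (negPf x0) => /eqP p1.
  by case/eqP: pv; apply: pointP; lra.
by apply: (addIr y); rewrite subrK; apply: (mulIf p0); rewrite divfK //; lra.
Qed.

Lemma spoke_exists h v r i : general_position [set` h] -> v \in h -> 0 < r ->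
  exists t e, [/\ -1 < t < 1, 0 < e, norm1 (e *: spoke i t) < r,
    legal h (v + e *: spoke i t) &
    forall a b, a \in h -> b \in h -> catches r (spoke i t) (a - v) (b - v) e].
Proof.
move=> gp vh r0; have [t t1 tp] := spoke_avoiding h v i; exists t.
have n0 : 0 < norm1 (spoke i t) by rewrite norm1_gt0 spoke_neq0.
have := small_and (small_and (small_legal gp vh (spoke_neq0 i t) tp) (small_lt (divr_gt0 r0 n0)))
  (small_all (s := h) (fun a _ => small_all (s := h)
     (fun b _ => small_catches (spoke i t) (a - v) (b - v) r0))).
case/small_exists => e e0 [[lg er] cat]; exists e; split=> //.
  by rewrite norm1Z gtr0_norm // -ltr_pdivlMr.
by move=> a b ah bh; exact: cat.
Qed.

(* [side k] is positive on the sector between spokes [k] and [k + 1 mod 3]. *)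
Definition side (k : nat) w : R :=
  if k == 0%N then w 0 0 + w 0 1 else if k == 1%N then - w 0 0 else w 0 0 - w 0 1.

Lemma sideN k w : side k (- w) = - side k w.
Proof. by rewrite /side !mxE; do 2?case: ifP => _; lra. Qed.

(** By the identity [id], a combination with positive weights vanishes. So the three determinants do
    not all have the same sign, and in cyclic order they drop from positive to negative
    somewhere. *)
Lemma sector_cases (u : nat -> point R) W :
  0 < cross (u 0) (u 1) -> 0 < cross (u 1) (u 2) -> 0 < cross (u 2) (u 0) ->
  (forall i, (i < 3)%N -> cross (u i) W != 0) ->
  exists2 k, (k < 3)%N & 0 < cross (u k) W /\ cross (u (k.+1 %% 3)%N) W < 0.
Proof.
move=> o01 o12 o20 nz.
have [n0 n1 n2] := And3 (nz 0 isT) (nz 1 isT) (nz 2 isT).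
have id : cross (u 1) (u 2) * cross (u 0) W + cross (u 2) (u 0) * cross (u 1) W +
  cross (u 0) (u 1) * cross (u 2) W = 0 by rewrite /cross; ring.
case: (ltgtP (cross (u 0) W) 0) n0 => // s0 _; case: (ltgtP (cross (u 1) W) 0) n1 => // s1 _;
  case: (ltgtP (cross (u 2) W) 0) n2 => // s2 _.
- by exfalso; nra.
- by exists 2.
- by exists 1.
- by exists 2.
- by exists 0.
- by exists 0.
- by exists 1.
- by exfalso; nra.
Qed.

(** Here [u] and [v] are consecutive spokes, [W] lies between them and [W'] beyond [v]. Depending on
    whether the turn from [W] to [W'] is less or more than a half-turn, [v] or [u] lies in the
    convex angle that they span. *)
Lemma sector_adjacent u v W W' : 0 < cross u v -> 0 < cross u W -> cross v W < 0 ->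
  0 < cross v W' -> cross u W' != 0 -> cross W W' != 0 ->
  [\/ [/\ 0 < cross W v, 0 < cross v W' & 0 < cross W W'] |
      [/\ 0 < cross W' u, 0 < cross u W & 0 < cross W' W]].
Proof.
move=> uv uW vW vW' uW' WW'.
have crossN A B : cross A B = - cross B A by rewrite /cross; ring.
have [lt|ge] := ltP 0 (cross W W'); first by left; split=> //; rewrite crossN; lra.
have {ge WW'}lt : cross W W' < 0 by rewrite lt_neqAle WW'.
right; split=> //; rewrite crossN oppr_gt0 //.
have id : cross u v * cross W W' + cross u W * - cross v W' + cross u W' * cross v W = 0.
  by rewrite /cross; ring.
by case: (ltgtP (cross u W') 0) uW' => // gt _; exfalso; nra.
Qed.

Lemma spoke_cross (t : nat -> R) (u := fun i => spoke i (t i)) : (forall i, -1 < t i < 1) ->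
  [/\ 0 < cross (u 0%N) (u 1%N), 0 < cross (u 1%N) (u 2%N) & 0 < cross (u 2%N) (u 0%N)].
Proof.
move=> t1; have := t1 0%N; have := t1 1%N; have := t1 2%N.
by rewrite /u /cross !mxE /=; split; lra.
Qed.

Lemma sector_side (t : nat -> R) (u := fun i => spoke i (t i)) k W : (forall i, -1 < t i < 1) ->
  (k < 3)%N -> 0 < cross (u k) W -> cross (u (k.+1 %% 3)%N) W < 0 -> 0 < side k W.
Proof.
move=> t1; have := t1 0%N; have := t1 1%N; have := t1 2%N => t2 {}t1 t0.
case: k => [|[|[|//]]] _; rewrite /u /side /cross !mxE /= => c c'.
- nra.
- nra.
- nra.
Qed.

(** Quantifying over all larger [S] lets the property survive later moves. [K] holds the points
    known when the cluster is built. A smaller [r] makes the property stronger, which is why a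
    cluster is renewed when its ball shrinks. *)
Definition guarded S0 v K r := forall S H, S0 `<=` S -> general_position S ->
  H `<=` S -> H v -> H `<=` vertices (conv_hull H) -> conv_hull H `&` S `<=` H ->
  (forall w, H w -> w != v -> r <= norm1 (w - v)) ->
  forall a b, K a -> K b -> H a -> H b -> a != v -> b != v -> a != b ->
  exists2 k, (k < 3)%N & forall w, H w -> w != v -> 0 < side k (w - v).

Lemma guarded_mono S S' v K K' r : S `<=` S' -> K' `<=` K ->
  guarded S v K r -> guarded S' v K' r.
Proof.
move=> SS' K'K g T H S'T gpT HT Hv HV CH far a b /K'K Ka /K'K Kb.
exact: (g T H (subset_trans SS' S'T) gpT HT Hv HV CH far a b Ka Kb).
Qed.

Fixpoint legal_seq h L := if L is x :: L' then legal h x /\ legal_seq (rcons h x) L' else True.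

Lemma legal_seq_cat h L L' : legal_seq h L -> legal_seq (h ++ L) L' -> legal_seq h (L ++ L').
Proof.
elim: L h => [|x L IH] h; first by rewrite cats0.
by move=> /= [hx hL] hL'; split=> //; apply: IH; rewrite // cat_rcons.
Qed.

Lemma legal_seq_nth h L j : legal_seq h L -> (j < size L)%N -> legal (h ++ take j L) (nth 0 L j).
Proof.
elim: L h j => [|x L IH] h [|j] //= [hx hL]; first by rewrite cats0.
by rewrite ltnS => /(IH _ _ hL); rewrite cat_rcons.
Qed.

Lemma legal_seq_take h L j : legal_seq h L -> legal_seq h (take j L).
Proof. by elim: L h j => [|x L IH] h [|j] //= [hx hL]; split=> //; exact: IH. Qed.

Lemma legal_seq_general_position h L : general_position [set` h] -> legal_seq h L ->
  general_position [set` h ++ L].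
Proof.
elim: L h => [|x L IH] h gp; first by rewrite cats0.
by move=> [[_ hx] hL]; rewrite -cat_rcons; exact: IH.
Qed.

(** A cluster point whose spoke runs inside an angle of [H] at [v] is caught in the hull, hence
    belongs to [H], although it is closer than [r] to [v]. With these angles free of spokes,
    [sector_adjacent] forces all of [H] into one sector. *)
Lemma guard_exists h v r : general_position [set` h] -> v \in h -> 0 < r ->
  exists L, [/\ size L = 3%N, legal_seq h L & guarded [set` h ++ L] v [set` h] r].
Proof.
move=> gp vh r0.
have [t0 [e0 [t0P e0P n0 l0 c0]]] := spoke_exists 0 gp vh r0.
set x0 := v + _ in l0; have [_ gp1] := l0.
have vh1 : v \in rcons h x0 by rewrite mem_rcons inE vh orbT.
have [t1 [e1 [t1P e1P n1 l1 c1]]] := spoke_exists 1 gp1 vh1 r0.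
set x1 := v + _ in l1; have [_ gp2] := l1.
have vh2 : v \in rcons (rcons h x0) x1 by rewrite mem_rcons inE vh1 orbT.
have [t2 [e2 [t2P e2P n2 l2 c2]]] := spoke_exists 2 gp2 vh2 r0.
set x2 := v + _ in l2.
exists [:: x0; x1; x2]; split=> // S H hS gpS HS Hv HV CH far a b /= ah bh Ha Hb av bv ab.
(* The default of [nth] doubles as the third entry, so that the bounds hold for every index. *)
pose t i := nth t2 [:: t0; t1] i; pose e i := nth e2 [:: e0; e1] i.
pose u i := spoke i (t i).
have tP i : -1 < t i < 1 by rewrite /t; case: i => [|[|[]]].
have eP i : 0 < e i by rewrite /e; case: i => [|[|[]]].
have Sc i : (i < 3)%N -> S (v + e i *: u i).
  by case: i => [|[|[|//]]] _; apply: hS; rewrite /= mem_cat !inE eqxx ?orbT.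
have nP i : (i < 3)%N -> norm1 (e i *: u i) < r by case: i => [|[|[|//]]].
have cP i a' b' : (i < 3)%N -> a' \in h -> b' \in h -> catches r (u i) (a' - v) (b' - v) (e i).
  have in1 p : p \in h -> p \in rcons h x0 by rewrite mem_rcons inE => ->; rewrite orbT.
  have in2 p : p \in h -> p \in rcons (rcons h x0) x1.
    by move=> /in1 p1; rewrite mem_rcons inE p1 orbT.
  case: i => [|[|[|//]]] _ a'h b'h; [exact: c0|exact: c1 (in1 _ a'h) (in1 _ b'h)|].
  exact: c2 (in2 _ a'h) (in2 _ b'h).
have cv i : v + e i *: u i != v.
  by rewrite -subr_eq0 [_ + e i *: _]addrC addrK scaler_eq0 (negPf (spoke_neq0 _ _)) gt_eqF.
(* No other point of [H] lies on the line of a spoke, which already contains [v] and a cluster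
   point. *)
have uw i w : (i < 3)%N -> H w -> w != v -> cross (u i) (w - v) != 0.
  move=> i3 Hw wv.
  have wc : v + e i *: u i != w.
    apply/eqP => cw; have := far w Hw wv.
    by rewrite -cw [_ + e i *: _]addrC addrK leNgt nP.
  have := general_position_cross gpS (HS _ Hv) (Sc i i3) (HS _ Hw) (cv i) wv wc.
  apply: contraNneq => c; have -> : cross (v + e i *: u i - v) (w - v) = e i * cross (u i) (w - v).
    by rewrite /cross !mxE; ring.
  by rewrite c mulr0.
have ab_cross : cross (a - v) (b - v) != 0.
  by apply: general_position_cross gpS _ _ _ av bv ab; exact: HS.
have missed i w w' : (i < 3)%N -> H w -> H w' -> w != v -> w' != v ->
    ~ [/\ 0 < cross (w - v) (u i), 0 < cross (u i) (w' - v) & 0 < cross (w - v) (w' - v)].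
  move=> i3 Hw Hw' wv w'v [wu uw' ww'].
  have Cc : conv_hull H (v + e i *: u i).
    have [lt|ge] := ltP 0 (cross (a - v) (b - v)).
      apply: (vertex_catch (HV _ Hv) Hw Hw' Ha Hb wu uw' ww' (far _ Hw wv) (far _ Hw' w'v)) => //;
        by [exact: uw | exact: cP].
    have gt : 0 < cross (b - v) (a - v).
      have -> : cross (b - v) (a - v) = - cross (a - v) (b - v) by rewrite /cross; ring.
      by rewrite oppr_gt0 lt_neqAle ab_cross.
    apply: (vertex_catch (HV _ Hv) Hw Hw' Hb Ha wu uw' ww' (far _ Hw wv) (far _ Hw' w'v)) => //;
      by [exact: uw | exact: cP].
  have := far _ (CH _ (conj Cc (Sc i i3))) (cv i).
  by rewrite [_ + e i *: _]addrC addrK leNgt nP.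
have [o01 o12 o20] := spoke_cross tP.
have sector w : H w -> w != v -> exists2 k, (k < 3)%N &
    0 < cross (u k) (w - v) /\ cross (u (k.+1 %% 3)%N) (w - v) < 0.
  by move=> Hw wv; apply: sector_cases => // i i3; exact: uw.
have not_adjacent k w w' : (k < 3)%N -> H w -> H w' -> w != v -> w' != v ->
    0 < cross (u k) (w - v) -> cross (u (k.+1 %% 3)%N) (w - v) < 0 ->
    ~ 0 < cross (u (k.+1 %% 3)%N) (w' - v).
  move=> k3 Hw Hw' wv w'v kw k'w k'w'.
  have ww' : w != w' by apply: contraTneq k'w' => <-; rewrite -leNgt ltW.
  have oriented : 0 < cross (u k) (u (k.+1 %% 3)%N) by case: k k3 {kw k'w k'w'} => [|[|[|//]]].
  have [] := sector_adjacent oriented kw k'w k'w' (uw _ _ k3 Hw' w'v).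
  - by apply: general_position_cross gpS _ _ _ wv w'v ww'; exact: HS.
  - by apply: missed => //; rewrite ltn_mod.
  - exact: missed.
have [k k3 [ka k'a]] := sector a Ha av.
exists k => // w Hw wv; have [j j3 [jw j'w]] := sector w Hw wv.
suff jk : j = k by apply: (sector_side tP k3); rewrite -/(u _) -jk.
(* Two different sectors out of three are cyclically adjacent in one order or the other. *)
case: (eqVneq j (k.+1 %% 3)%N) => [jk|jk].
  by case: (not_adjacent k a w k3 Ha Hw av wv ka k'a); rewrite -jk.
case: (eqVneq k (j.+1 %% 3)%N) => [kj|kj].
  by case: (not_adjacent j w a j3 Hw Ha wv av jw j'w); rewrite -kj.
by move: j k j3 k3 jk kj {jw j'w ka k'a} => [|[|[|//]]] [|[|[|//]]].
Qed.

End Guard.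

(** * Counting the vertices of a hole, and the invariant kept from round to round *)

Section Game.
Variable R : realType.
Implicit Types (x y v w : point R) (h L g : seq (point R)) (S H : set (point R)).

Lemma card_le_size (T : Type) (U : eqType) (A : set T) (f : U -> T) (s : seq U) k :
  A #= `I_k -> A `<=` f @` [set` s] -> (k <= size s)%N.
Proof.
case: s => [|u s] Ak sub.
  have A0 : A = set0 by apply/seteqP; split => // z /sub [].
  by move: Ak; rewrite A0 card_eq_sym card_eq0 => /eqP /seteqP [+ _]; case: k => // k /(_ 0%N) [].
rewrite -card_le_II -(card_le_eql Ak).
apply: card_le_trans (card_image_le (f \o nth u (u :: s)) `I_(size (u :: s))).
apply: subset_card_le => z /sub [w /= ws <-]; exists (index w (u :: s)); first by move: ws; rewrite -index_mem.
by congr f; exact: nth_index.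
Qed.

Lemma size_filter_predC1 (T : eqType) (x : T) (s : seq T) : uniq s ->
  (size s <= (size [seq y <- s | y != x]).+1)%N.
Proof.
move=> us; rewrite size_filter -(count_predC (pred1 x) s) -addn1 addnC leq_add2l.
by rewrite count_uniq_mem // leq_b1.
Qed.

(* [i0] and [i1] are the points whose cluster may be missing or outdated: Maker's
   last point and the point in whose ball it fell. *)
Lemma guarded_no_hole k S H (p : nat -> point R) (r : nat -> R) n i0 i1 : (8 <= k)%N ->
  general_position S -> H `<=` p @` `I_n ->
  (forall i j, (i < j < n)%N -> p i != p j) ->
  (forall i, (i < n)%N -> i != i0 -> i != i1 ->
    guarded S (p i) (p @` `I_i) (r i) /\
    forall j, (j < n)%N -> j != i -> r i <= norm1 (p j - p i)) ->
  ~ hole k S H.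
Proof.
move=> k8 gpS Hp p_inj gd hole_H; have [HS Hk _ CH] := hole_H.
have HV := hole_vertices hole_H.
have {}p_inj i j : (i < n)%N -> (j < n)%N -> i != j -> p i != p j.
  by case: (ltngtP i j) => // ij i_n j_n _; [|rewrite eq_sym]; apply: p_inj; rewrite ij.
pose s := [seq i <- iota 0 n | `[< H (p i) >]].
have sP i : i \in s -> (i < n)%N /\ H (p i).
  by rewrite mem_filter mem_iota /= => /andP[/asboolP Hi i_n].
have k_le : (k <= size s)%N.
  apply: (card_le_size (f := p) Hk) => w Hw; have [i i_n pw] := Hp w Hw.
  by exists i; rewrite //= mem_filter mem_iota /= i_n andbT; apply/asboolP; rewrite pw.
have s_sorted : sorted ltn s by apply: sorted_filter; [exact: ltn_trans | exact: iota_ltn_sorted].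
have s_uniq : uniq s by rewrite filter_uniq // iota_uniq.
(* The list is sorted by time, so [a] and [b] are the two oldest vertices, known to the clusters of
   the later ones. *)
case E : s => [|a [|b t]]; rewrite E in k_le s_sorted s_uniq; try by have := leq_trans k8 k_le.
have [Sa Sb St] : [/\ (a < n)%N /\ H (p a), (b < n)%N /\ H (p b) & forall i, i \in t -> (i < n)%N /\ H (p i)].
  by split=> [||i it]; apply: sP; rewrite E !inE ?eqxx ?it ?orbT.
pose t' := [seq i <- [seq i <- t | i != i0] | i != i1].
have /and3P[_ _ t_uniq] := s_uniq.
have t'_uniq : uniq t' by rewrite !filter_uniq.
(* Eight vertices without the two oldest and the two exceptional ones leave four, one more than
   there are linear forms. *)
have size_t' : (4 <= size t')%N.
  have := size_filter_predC1 i0 t_uniq; have := size_filter_predC1 i1 (filter_uniq (fun i => i != i0) t_uniq).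
  by rewrite -/t'; move: k_le => /= *; lia.
have t'P i : i \in t' -> [/\ i \in t, i != i0 & i != i1].
  by rewrite !mem_filter => /and3P[].
have late i : i \in t -> (a < b < i)%N.
  move=> it; move: s_sorted => /= /andP[ab]; rewrite ab => /(order_path_min ltn_trans) /allP.
  exact.
have /choice[q qP] : forall i, exists q, i \in t' -> (q < 3)%N /\
    forall w, H w -> w != p i -> 0 < side q (w - p i).
  move=> i; have [it'|] := boolP (i \in t'); last by exists 0%N.
  have [it ii0 ii1] := t'P i it'; have [i_n Hi] := St i it; have /andP[ab bi] := late i it.
  have [gi far] := gd i i_n ii0 ii1.
  have farH w : H w -> w != p i -> r i <= norm1 (w - p i).
    move=> Hw wi; have [j j_n pj] := Hp w Hw; rewrite -pj; apply: far => //.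
    by apply: contra_neq wi => ji; rewrite -pj ji.
  have Ka : (p @` `I_i) (p a) by exists a => //=; exact: ltn_trans ab bi.
  have Kb : (p @` `I_i) (p b) by exists b.
  have CHH : conv_hull H `&` S `<=` H by rewrite CH.
  have ai : p a != p i by apply: p_inj Sa.1 i_n _; rewrite ltn_eqF // (ltn_trans ab).
  have bi' : p b != p i by apply: p_inj Sb.1 i_n _; rewrite ltn_eqF.
  have ab' : p a != p b by apply: p_inj Sa.1 Sb.1 _; rewrite ltn_eqF.
  have [q q3 qs] := gi S H (@subset_refl _ S) gpS HS Hi HV CHH farH _ _ Ka Kb Sa.2 Sb.2 ai bi' ab'.
  by exists q.
(* A shared form would be positive on the difference of the two vertices and on its negative. *)
have q_inj : {in t' &, injective q}.
  move=> i j it jt qij; apply: contrapT => /eqP ij.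
  have [/St [i_n Hi] _ _] := t'P i it; have [/St [j_n Hj] _ _] := t'P j jt.
  have := (qP i it).2 _ Hj; rewrite p_inj // 1?eq_sym // => /(_ isT).
  have := (qP j jt).2 _ Hi; rewrite p_inj // => /(_ isT).
  by rewrite -qij -opprB sideN; lra.
have : (size (map q t') <= size (iota 0 3))%N.
  apply: uniq_leq_size; first by rewrite map_inj_in_uniq.
  by move=> _ /mapP[i it ->]; rewrite mem_iota /=; case: (qP i it).
by rewrite size_map size_iota; lia.
Qed.

(** A round has 13 placements, the first of them Maker's. *)
Definition maker_point h (i : nat) : point R := nth 0 h (13 * i).

(** The invariant between rounds: disjoint balls of radii [r i], each with a cluster that knows
    Maker's earlier points. *)
Definition defended h (m : nat) := [/\ size h = (13 * m)%N, general_position [set` h] &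
  exists r : nat -> R, [/\ forall i, (i < m)%N -> 0 < r i,
    forall i j, (i < j < m)%N -> r i + r j < norm1 (maker_point h i - maker_point h j) &
    forall i, (i < m)%N -> guarded [set` h] (maker_point h i) (maker_point h @` `I_i) (r i)]].

Lemma defended_nil : defended [::] 0.
Proof.
split; [by []|by move=> x y z /=; rewrite in_nil|].
by exists (fun=> 1); split=> // i j; rewrite ltn0 andbF.
Qed.

Lemma maker_points_sub h n : (size h <= 13 * n)%N -> maker_points 12 h `<=` maker_point h @` `I_n.
Proof.
move=> hn _ [i /= /andP[ih /dvdnP[q iq]] <-]; exists q; rewrite /= /maker_point ?iq ?(mulnC 13) //.
by move: ih; rewrite iq; lia.
Qed.

Lemma norm1_sub_gt0_neq x y (r : R) : 0 < r -> r < norm1 (x - y) -> x != y.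
Proof. by move=> r0 rxy; rewrite -subr_eq0 -norm1_gt0 (lt_trans r0). Qed.

Lemma defended_not_won h m k : (8 <= k)%N -> defended h m -> ~ maker_won 12 k h.
Proof.
move=> k8 [size_h gp [r [r0 sep gd]]] [H [hole_H HM]].
have apart i j : (i < m)%N -> (j < m)%N -> j != i -> r i < norm1 (maker_point h j - maker_point h i).
  move=> i_m j_m; have := r0 i i_m; have := r0 j j_m; case: (ltngtP i j) => // ij rj ri _.
    by have := sep i j; rewrite ij j_m -norm1N opprB => /(_ isT); lra.
  by have := sep j i; rewrite ij i_m => /(_ isT); lra.
(* Both exceptional indices are [m], which is out of range: after a complete round there are no
   exceptions. *)
apply: (@guarded_no_hole k [set` h] H (maker_point h) r m m m k8 gp _ _ _ hole_H).
- by apply: subset_trans HM _; apply: maker_points_sub; rewrite size_h.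
- move=> i j /andP[ij j_m]; have i_m := ltn_trans ij j_m.
  by apply: (norm1_sub_gt0_neq (r0 j j_m)); apply: apart => //; rewrite ltn_eqF.
- by move=> i i_m _ _; split=> [|j j_m ji]; [exact: gd | exact/ltW/apart].
Qed.

Lemma maker_point_cat h y L i m : size h = (13 * m)%N -> (i < m)%N ->
  maker_point (rcons h y ++ L) i = maker_point h i.
Proof.
move=> size_h i_m; have i_h : (13 * i < size h)%N by rewrite size_h; lia.
by rewrite /maker_point nth_cat size_rcons ltnS (ltnW i_h) nth_rcons i_h.
Qed.

Lemma maker_point_last h y L m : size h = (13 * m)%N -> maker_point (rcons h y ++ L) m = y.
Proof. by move=> size_h; rewrite /maker_point nth_cat size_rcons -size_h ltnSn nth_rcons ltnn eqxx. Qed.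

(** By the triangle inequality [y] cannot lie in two of the disjoint balls. The value [m] encodes
    that no ball is hit; it is also the index that [y] will get. *)
Lemma at_most_one_close h m y (r : nat -> R) :
  (forall i j, (i < j < m)%N -> r i + r j < norm1 (maker_point h i - maker_point h j)) ->
  exists2 j, (j <= m)%N &
    forall i, (i < m)%N -> i != j -> r i < norm1 (y - maker_point h i).
Proof.
move=> sep; case: (pselect (exists2 j, (j < m)%N & norm1 (y - maker_point h j) <= r j)); last first.
  move=> far; exists m => // i i_m _; rewrite ltNge; apply/negP => le; apply: far.
  by exists i.
move=> [j j_m close_j]; exists j; first exact: ltnW.
move=> i i_m ij; rewrite ltNge; apply/negP => close_i.
have := norm1_triangle (maker_point h i - y) (y - maker_point h j).
rewrite addrA subrK -(norm1N (maker_point h i - y)) opprB => tri.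
case: (ltngtP i j) ij => // ij _; first by have := sep i j; rewrite ij j_m => /(_ isT); lra.
have := sep j i; rewrite ij i_m => /(_ isT).
by rewrite -(norm1N (maker_point h j - _)) opprB; lra.
Qed.

(** This handles positions in the middle of Breaker's reply: the new point and the one in whose ball
    it fell are the exceptions, and the other clusters stay valid as [S] grows. *)
Lemma defended_no_hole h m y S H k : (8 <= k)%N -> defended h m -> y \notin h ->
  [set` h] `<=` S -> general_position S ->
  H `<=` maker_point (rcons h y) @` `I_m.+1 -> ~ hole k S H.
Proof.
move=> k8 [size_h gp [r [r0 sep gd]]] yh hS gpS HM.
have [j0 j0_m far] := at_most_one_close y sep.
have old i : (i < m)%N -> maker_point (rcons h y) i = maker_point h i.
  by move=> i_m; rewrite -[rcons h y]cats0; exact: maker_point_cat size_h i_m.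
have new : maker_point (rcons h y) m = y.
  by rewrite -[rcons h y]cats0; exact: maker_point_last.
have apart i j : (i < m)%N -> (j < m)%N -> j != i -> r i < norm1 (maker_point h j - maker_point h i).
  move=> i_m j_m; have := r0 i i_m; have := r0 j j_m; case: (ltngtP i j) => // ij rj ri _.
    by have := sep i j; rewrite ij j_m -norm1N opprB => /(_ isT); lra.
  by have := sep j i; rewrite ij i_m => /(_ isT); lra.
apply: (@guarded_no_hole k S H _ r m.+1 m j0 k8 gpS HM).
- move=> i j /andP[ij]; rewrite ltnS leq_eqVlt => /predU1P[j_m|j_m].
    rewrite j_m in ij *; rewrite new old //; apply: contraNneq yh => <-.
    by rewrite mem_nth // size_h; lia.
  have i_m := ltn_trans ij j_m; rewrite !old //.
  by apply: (norm1_sub_gt0_neq (r0 j j_m)); apply: apart => //; rewrite ltn_eqF.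
- move=> i; rewrite ltnS leq_eqVlt => /predU1P[->|i_m _ ij0]; first by rewrite eqxx.
  rewrite old //; split.
    apply: guarded_mono hS _ (gd i i_m) => w [j /= ji <-].
    by exists j => //; rewrite old // (ltn_trans ji).
  move=> j; rewrite ltnS leq_eqVlt => /predU1P[->|j_m] ji; apply/ltW.
    by rewrite new; exact: far.
  by rewrite old //; exact: apart.
Qed.

(* A round costs at most two clusters, one around Maker's new point and one
   around the unique old point in whose ball it fell; the remaining six
   placements repeat the new point's cluster. *)
Lemma round h m y : defended h m -> legal h y ->
  exists L, [/\ size L = 12%N, legal_seq (rcons h y) L & defended (rcons h y ++ L) m.+1].
Proof.
move=> [size_h gp [r [r0 sep gd]]] [yh gpy].
have [j0 j0_m far] := at_most_one_close y sep.
have y_neq i : (i < m)%N -> y != maker_point h i.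
  by move=> i_m; apply: contraNneq yh => ->; rewrite mem_nth // size_h; lia.
(* The new radius [d], for [y] and for the ball that it hit, is below every old radius and small
   enough to keep all balls disjoint. *)
have : small (fun d : R => forall i, i \in iota 0 m ->
    d < r i /\ if i == j0 then d + d < norm1 (maker_point h i - y)
               else r i + d < norm1 (maker_point h i - y)).
  apply: small_all => i; rewrite mem_iota /= add0n => i_m.
  have n0 : 0 < norm1 (maker_point h i - y) by rewrite norm1_gt0 subr_eq0 eq_sym y_neq.
  apply: small_and; first exact: small_lt (r0 i i_m).
  case: eqVneq => [_|ij].
    have := small_lt (divr_gt0 n0 (ltr0Sn R 1)); apply: small_imp => d d0; lra.
  have lt : 0 < norm1 (maker_point h i - y) - r i.
    by rewrite subr_gt0 -norm1N opprB; exact: far.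
  by have := small_lt lt; apply: small_imp => d d0; lra.
case/small_exists => d d0 dP.
have {}dP i : (i < m)%N -> d < r i /\ if i == j0 then d + d < norm1 (maker_point h i - y)
    else r i + d < norm1 (maker_point h i - y).
  by move=> i_m; apply: dP; rewrite mem_iota.
pose p := maker_point (rcons h y).
have old i : (i < m)%N -> p i = maker_point h i.
  by move=> i_m; rewrite /p -[rcons h y]cats0; exact: maker_point_cat size_h i_m.
have new : p m = y.
  by rewrite /p -[rcons h y]cats0; exact: maker_point_last.
have p_in i : (i <= m)%N -> p i \in rcons h y.
  by move=> i_m; rewrite mem_nth // size_rcons size_h; lia.
(* If [y] hit no ball, [j0] is [m] and this cluster too surrounds [y]. *)
have [L1 [s1 l1 g1]] := guard_exists gpy (p_in j0 j0_m) d0.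
have gp1 := legal_seq_general_position gpy l1.
have y1 : y \in rcons h y ++ L1 by rewrite mem_cat mem_rcons mem_head.
have [L2 [s2 l2 g2]] := guard_exists gp1 y1 d0.
have gp2 := legal_seq_general_position gp1 l2.
have y2 : y \in (rcons h y ++ L1) ++ L2 by rewrite mem_cat y1.
have [L3 [s3 l3 _]] := guard_exists gp2 y2 d0.
have gp3 := legal_seq_general_position gp2 l3.
have y3 : y \in ((rcons h y ++ L1) ++ L2) ++ L3 by rewrite mem_cat y2.
have [L4 [s4 l4 _]] := guard_exists gp3 y3 d0.
exists (((L1 ++ L2) ++ L3) ++ L4).
have lL : legal_seq (rcons h y) (((L1 ++ L2) ++ L3) ++ L4).
  by do 3 (apply: legal_seq_cat; last by rewrite ?catA).
set L := _ ++ L4 in lL *.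
have size_L : size L = 12%N by rewrite /L !size_cat s1 s2 s3 s4.
split=> //; split; first by rewrite size_cat size_rcons size_h size_L; lia.
  exact: legal_seq_general_position.
have pE i : (i <= m)%N -> maker_point (rcons h y ++ L) i = p i.
  rewrite leq_eqVlt => /predU1P[->|i_m]; first by rewrite new; exact: maker_point_last.
  by rewrite old //; exact: maker_point_cat size_h i_m.
have sub1 : [set` rcons h y ++ L1] `<=` [set` rcons h y ++ L].
  by move=> x; rewrite /L /= !mem_cat => /orP[->|->]; rewrite ?orbT.
have sub2 : [set` (rcons h y ++ L1) ++ L2] `<=` [set` rcons h y ++ L].
  by move=> x; rewrite /L /= !mem_cat => /orP[/orP[->|->]|->]; rewrite ?orbT.
have subh : [set` h] `<=` [set` rcons h y ++ L].
  by move=> x /= xh; rewrite mem_cat mem_rcons inE xh orbT.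
have earlier i : (i <= m)%N -> maker_point (rcons h y ++ L) @` `I_i `<=` [set` rcons h y].
  by move=> i_m _ [j /= ji <-]; rewrite pE ?p_in // ltnW // (leq_trans ji).
exists (fun i => if (i == j0) || (i == m) then d else r i); split.
- by move=> i; rewrite ltnS leq_eqVlt; case: eqVneq => [//|_] /=; case: eqVneq => //= _; exact: r0.
- move=> i j /andP[ij]; rewrite ltnS leq_eqVlt => /predU1P[j_m|j_m].
    rewrite j_m in ij *; rewrite !pE ?(ltnW ij) // new old // eqxx orbT (ltn_eqF ij) orbF.
    by case: ifP (dP i ij) => ? [].
  have i_m := ltn_trans ij j_m.
  rewrite !pE ?(ltnW i_m) ?(ltnW j_m) // !old // (ltn_eqF i_m) (ltn_eqF j_m) !orbF.
  have := sep i j; rewrite ij j_m => /(_ isT) lt.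
  have [di _] := dP i i_m; have [dj _] := dP j j_m.
  by do 2?case: ifP => _; lra.
- move=> i; rewrite ltnS leq_eqVlt => i_m.
  have [->|i_neq] := eqVneq i m.
    rewrite orbT pE // new; apply: guarded_mono sub2 _ g2.
    by move=> x /(earlier _ (leqnn m)) /=; rewrite mem_cat => ->.
  rewrite (negPf i_neq) /= in i_m; rewrite orbF pE ?(ltnW i_m) //.
  case: eqVneq => [->|ij0]; first exact: guarded_mono sub1 (earlier _ j0_m) g1.
  rewrite old //; apply: guarded_mono subh _ (gd i i_m) => x [j /= ji <-].
  by exists j => //; have j_m := ltn_trans ji i_m; rewrite pE ?old // ltnW.
Qed.

End Game.

(** * Breaker's strategy *)

Theorem theorem8 (R : realType) (k : nat) (hk : (8 <= k)%N) :
  breaker_has_winning_strategy R 12 k.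
Proof.
(* A whole reply [L] is fixed at once for the position [g] just after Maker's move; positions of any
   other shape impose nothing on it. *)
pose good (g L : seq (point R)) := forall h y m, g = rcons h y -> defended h m -> legal h y ->
  [/\ size L = 12%N, legal_seq g L & defended (g ++ L) m.+1].
have /choice[f fP] : forall g, exists L, good g L.
  move=> g; case: (pselect (exists h y m, [/\ g = rcons h y, defended h m & legal h y])); last first.
    by move=> none; exists [::] => h y m gE hm hy; case: none; exists h, y, m.
  move=> [h [y [m [-> hm hy]]]]; have [L [sL lL dL]] := round hm hy.
  exists L => h' y' m' /rcons_inj [hh' _] hm' _; split=> //.
  have [size_h _ _] := hm; have [size_h' _ _] := hm'.
  suff -> : m' = m by [].
  by move: size_h'; rewrite -hh' size_h; lia.
(* The prefix consists of the completed rounds and Maker's latest point. Just after Maker's move the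
   size is 1 modulo 13, hence the predecessor. *)
pose sigma (h : history R) := nth 0 (f (take (13 * (size h %/ 13)).+1 h)) (size h %% 13).-1.
exists sigma.
have reply h y m j : defended h m -> legal h y -> (j < 12)%N ->
    sigma (rcons h y ++ take j (f (rcons h y))) = nth 0 (f (rcons h y)) j.
  move=> hm hy j12; have [size_h _ _] := hm; have [size_L _ _] := fP _ _ _ _ erefl hm hy.
  have size_g : size (rcons h y ++ take j (f (rcons h y))) = (m * 13 + j.+1)%N.
    by rewrite size_cat size_rcons size_h size_takel ?size_L ?(ltnW j12) //; lia.
  have j13 : (j.+1 < 13)%N by [].
  rewrite /sigma size_g divnMDl // divn_small // addn0 modnMDl modn_small //=.
  by rewrite take_size_cat // size_rcons size_h.
(* A reachable position is a completed round or Maker's move followed by a proper prefix of the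
   planned reply; the full reply counts as a completed round. *)
have state h : reachable 12 sigma h -> exists m h0, defended h0 m /\
    (h = h0 \/ exists y j, [/\ legal h0 y, (j < 12)%N & h = rcons h0 y ++ take j (f (rcons h0 y))]).
  elim=> {h} [|h x _ [m [h0 [dh0 hE]]] turn lx|h _ [m [h0 [dh0 hE]]] turn].
  - by exists 0%N, [::]; split; [exact: defended_nil | left].
  - have [size_h0 _ _] := dh0.
    exists m, h0; split=> //; right; case: hE => [hh0|[y [j [hy j12 hE]]]].
      by exists x, 0%N; rewrite take0 cats0 -hh0.
    have [size_L _ _] := fP _ _ _ _ erefl dh0 hy.
    move: turn; rewrite /maker_index hE size_cat size_rcons size_h0.
    by rewrite size_takel ?size_L ?(ltnW j12) // => /dvdnP[q]; lia.
  - have [size_h0 _ _] := dh0; case: hE => [hh0|[y [j [hy j12 hE]]]].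
      by move: turn; rewrite hh0 /maker_index size_h0 dvdn_mulr.
    have [size_L _ dL] := fP _ _ _ _ erefl dh0 hy.
    have next : rcons h (sigma h) = rcons h0 y ++ take j.+1 (f (rcons h0 y)).
      by rewrite hE (reply _ _ _ _ dh0 hy j12) (take_nth 0) ?size_L // rcons_cat.
    have [j11|j11] := eqVneq j.+1 12%N.
      exists m.+1, (rcons h0 y ++ f (rcons h0 y)); split=> //; left.
      by rewrite next take_oversize // size_L j11.
    exists m, h0; split=> //; right; exists y, j.+1; split=> //.
    by rewrite ltn_neqAle j11.
move=> h /state [m [h0 [dh0 [->|[y [j [hy j12 ->]]]]]]].
  have [size_h0 _ _] := dh0.
  by rewrite /maker_index size_h0 dvdn_mulr; split=> //; exact: defended_not_won dh0.
have [size_h0 _ _] := dh0; have [size_L lL _] := fP _ _ _ _ erefl dh0 hy.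
split=> [_|[H [hole_H HM]]].
  by rewrite (reply _ _ _ _ dh0 hy j12); apply: legal_seq_nth; rewrite ?size_L.
have [yh gpy] := hy.
apply: (defended_no_hole hk dh0 yh _ _ _ hole_H).
- by move=> x /= xh; rewrite mem_cat mem_rcons inE xh orbT.
- by apply: legal_seq_general_position gpy _; exact: legal_seq_take.
- apply: subset_trans HM _; apply: subset_trans (maker_points_sub (n := m.+1) _) _.
    by rewrite size_cat size_rcons size_h0 size_takel ?size_L ?(ltnW j12) //; lia.
  move=> _ [i /= i_m <-]; exists i => //; rewrite /maker_point nth_cat size_rcons size_h0.
  by rewrite ltnS leq_mul.
Qed.
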